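(* (Scalar triple product theorem) Let $\mathbb{F}$ be a field of characteristic not $2$ and let $B$ be an invertible symmetric $3\times 3$ matrix over $\mathbb{F}$. Let $v_1,v_2,v_3$ be vectors in $\mathbb{V}^3=\mathbb{F}^3$ and let $M=\begin{pmatrix} v_1 \\ v_2 \\ v_3 \end{pmatrix}$ be the matrix with these vectors as rows. Then $$\left[v_1,v_2,v_3\right]_B=(\det B)(\det M).$$
   Context: $\mathbb{V}^3$ is the space of row vectors over $\mathbb{F}$. The $B$-scalar product is $v\cdot_B w=vBw^T$. The Euclidean vector product is $(x_1,y_1,z_1)\times(x_2,y_2,z_2)=(y_1z_2-y_2z_1,\;x_2z_1-x_1z_2,\;x_1y_2-x_2y_1)$. The $B$-vector product is $v\times_B w=(v\times w)\,\mathrm{adj}\,B$ (row vector times matrix), where $\mathrm{adj}\,B=(\det B)B^{-1}$ is the adjugate of $B$. The $B$-scalar triple product is $[v_1,v_2,v_3]_B=v_1\cdot_B(v_2\times_B v_3)$. *)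

(* Defs.v *)
From mathcomp Require Import all_boot all_algebra.
Set Implicit Arguments.
Unset Strict Implicit.
Unset Printing Implicit Defensive.
Import GRing.Theory.
Local Open Scope ring_scope.

Definition sprod (F : fieldType) (B : 'M[F]_3) (v w : 'rV[F]_3) : F :=
  (v *m B *m w^T) 0 0.

(* Column indices 0, 1, 2 are the elements of the ring 'I_3 = Z/3Z, with
   underlying naturals 0, 1, 2. *)
Definition cross (F : fieldType) (v w : 'rV[F]_3) : 'rV[F]_3 :=
  let x1 := v 0 0 in let y1 := v 0 1 in let z1 := v 0 2 in
  let x2 := w 0 0 in let y2 := w 0 1 in let z2 := w 0 2 in
  \row_(j < 3) [:: y1 * z2 - y2 * z1; x2 * z1 - x1 * z2; x1 * y2 - x2 * y1]`_j.

(* \adj B is the transposed cofactor matrix, which for B \in unitmx equals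
   \det B *: invmx B. *)
Definition vprod (F : fieldType) (B : 'M[F]_3) (v w : 'rV[F]_3) : 'rV[F]_3 :=
  cross v w *m \adj B.

Definition striple (F : fieldType) (B : 'M[F]_3) (v1 v2 v3 : 'rV[F]_3) : F :=
  sprod B v1 (vprod B v2 v3).

Definition rows3 (F : fieldType) (v1 v2 v3 : 'rV[F]_3) : 'M[F]_3 :=
  \matrix_(i < 3) [:: v1; v2; v3]`_i.

(* Main.v *)
Require Import Defs.
From mathcomp Require Import all_boot all_algebra.
From mathcomp Require Import ring.
Import GRing.Theory.
Local Open Scope ring_scope.

(** The triple product is [v1 B (c adj B)^T], where [c] is the Euclidean vector
    product of [v2] and [v3].  Distributing the transpose brings [B] next to the
    transpose of its adjugate.  Since [B] is symmetric, so is [adj B], and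
    [B adj B] is the scalar matrix [det B].  What remains is the Euclidean triple
    product of [v1] and [c], which equals [det M]: the entries of [c] are the
    cofactors of the first row of [M] ([cofactor_rows3]), so it is the Laplace
    expansion of [det M] along that row ([det_rows3]). *)

Lemma det_mx22 (R : comNzRingType) (A : 'M[R]_2) :
  \det A = A 0 0 * A 1 1 - A 0 1 * A 1 0.
Proof.
rewrite (expand_det_row _ 0) !big_ord_recl big_ord0 /cofactor !det_mx11 !mxE /=.
have -> : lift 0 0 = 1 :> 'I_2 by apply: val_inj.
have -> : lift 1 0 = 0 :> 'I_2 by apply: val_inj.
by rewrite !addn0 expr0 expr1 addr0 mul1r mulN1r mulrN.
Qed.

(** Deleting the first row and the [j]-th column of [rows3 u v w] leaves the
    2 x 2 minor of [v] and [w] whose signed value is the [j]-th coordinate of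
    [cross v w]; the sign of the middle cofactor is absorbed in [cross] by the
    exchange of its two products. *)
Lemma cofactor_rows3 (F : fieldType) (u v w : 'rV[F]_3) (j : 'I_3) :
  cofactor (rows3 u v w) 0 j = cross v w 0 j.
Proof.
rewrite /cofactor det_mx22 !mxE /=.
have liftE (i l : 'I_3) (k : 'I_2) : bump i k = l -> lift i k = l.
  by move=> bump_ik; apply: val_inj.
case: j => [[|[|[|//]]] lt_j] /=.
- by rewrite (liftE _ 1 0) // (liftE _ 2 1) //; ring.
- by rewrite (liftE _ 0 0) // (liftE _ 2 1) //; ring.
- by rewrite (liftE _ 0 0) // (liftE _ 1 1) //; ring.
Qed.

Lemma det_rows3 (F : fieldType) (u v w : 'rV[F]_3) :
  \det (rows3 u v w) = (u *m (cross v w)^T) 0 0.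
Proof.
rewrite (expand_det_row _ 0) [RHS]mxE; apply: eq_bigr => j _.
by rewrite cofactor_rows3 !mxE.
Qed.

Theorem theorem2 (F : fieldType) (hF : 2%N \notin [pchar F])
    (B : 'M[F]_3) (hBunit : B \in unitmx) (hBsym : B^T = B)
    (v1 v2 v3 : 'rV[F]_3) :
  striple B v1 v2 v3 = \det B * \det (rows3 v1 v2 v3).
Proof.
rewrite /striple /sprod /vprod det_rows3 trmx_mul trmx_adj hBsym.
by rewrite mulmxA -(mulmxA v1) mul_mx_adj mul_mx_scalar -scalemxAl mxE.
Qed.
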